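(* Let $G$ be a finite nonnilpotent group. Then $$|\rho^{*}(G)|<2\,\sigma^{*}(G).$$
   Context: Let $G$ be a finite group and $x\in G$. Denote by $G_x$ the smallest subnormal subgroup of $G$ containing $x$ (that is, the intersection of all subnormal subgroups of $G$ containing $x$). The sub-class of $x$ in $G$ is $x^{G^{*}}:=x^{G_x}=\{x^g: g\in G_x\}$, the conjugacy class of $x$ in the group $G_x$; its size $|x^{G^{*}}|=[G_x:C_{G_x}(x)]$ is called a sub-class size of $G$. For a positive integer $n$, $\pi(n)$ denotes the set of prime divisors of $n$. Set $$\rho^{*}(G)=\bigcup_{x\in G}\pi\bigl(|x^{G^{*}}|\bigr),\qquad \sigma^{*}(G)=\max_{x\in G}\bigl|\pi\bigl(|x^{G^{*}}|\bigr)\bigr|.$$ *)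

(* Defs.v *)
From mathcomp Require Import all_boot all_fingroup all_solvable.
Set Implicit Arguments.
Unset Strict Implicit.
Unset Printing Implicit Defensive.

Local Open Scope group_scope.

Section SubClass.

Variable gT : finGroupType.
Implicit Types (G H : {group gT}) (x : gT).

(* G_x; only meaningful when x \in G. *)
Definition subnormal_closure G x : {set gT} :=
  \bigcap_(H : {group gT} | (H <|<| G) && (x \in H)) H.

Canonical subnormal_closure_group G x := [group of subnormal_closure G x].

Definition sub_class G x : {set gT} := x ^: subnormal_closure G x.

(* A duplicate-free sequence, so that its size is the cardinal of the set of
   primes; see mem_rho_star. *)
Definition rho_star G : seq nat :=
  undup (flatten [seq primes #|sub_class G x| | x in G]).

Definition sigma_star G : nat :=
  \max_(x in G) size (primes #|sub_class G x|).

Lemma mem_rho_star G p :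
  reflect (exists2 x, x \in G & p \in \pi(#|sub_class G x|))
          (p \in rho_star G).
Proof.
rewrite mem_undup; apply: (iffP flatten_imageP) => -[x Gx px];
  by exists x => //; move: px.
Qed.

Lemma mem_subnormal_closure G x : x \in subnormal_closure G x.
Proof. by apply/bigcapP=> H /andP[]. Qed.

Lemma subnormal_closure_min G H x :
  H <|<| G -> x \in H -> subnormal_closure G x \subset H.
Proof. by move=> snHG Hx; apply: bigcap_inf; rewrite snHG. Qed.

Lemma subnormal_closure_subnormal G x :
  x \in G -> subnormal_closure G x <|<| G.
Proof.
move=> Gx; have sKG : subnormal_closure G x \subset G.
  exact: subnormal_closure_min (subnormal_refl G) Gx.
rewrite -(setIidPr sKG) /subnormal_closure.
pose sn (A : {set gT}) := exists2 K : {group gT}, A = K & G :&: K <|<| G.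
suff [K -> //] : sn (\bigcap_(H : {group gT} | (H <|<| G) && (x \in H)) H).
apply: big_ind => [|_ _ [A -> snA] [B -> snB]|H /andP[snH _]].
- by exists [set: gT]%G => //=; rewrite setIT subnormal_refl.
- exists (A :&: B)%G => //=; apply: subnormal_trans snA.
  have := setI_subnormal (subsetIl G A) snB.
  by rewrite /= setIACA setIid (setIC B).
- by exists H => //; rewrite (setIidPr (subnormal_sub snH)).
Qed.

Lemma card_sub_class G x :
  #|sub_class G x| = #|subnormal_closure G x : 'C_(subnormal_closure G x)[x]|.
Proof. by rewrite index_cent1. Qed.

End SubClass.

(* Main.v *)
(** For a prime p let D_p be the set of x in G such that p does not divide
    |x^{G*}|; equivalently, x centralises a Sylow p-subgroup of some subnormal
    subgroup containing x. If G is p-nilpotent, then O_{p'}(G)<x> is subnormal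
    and D_p = G. If G is not p-nilpotent, then 2|D_p| <= |G|: by induction one
    may assume that all proper quotients of G are p-nilpotent, and one takes a
    minimal normal subgroup M. If M is abelian, it is a p-group, every x in D_p
    has a subnormal closure acting on M as a p-group, hence trivially, and so
    D_p lies in the proper subgroup C_G(M). If M is nonabelian, every x in D_p
    centralises a Sylow p-subgroup P of M, and these x number at most
    |G : N_G(P)| |C_G(P)|, which is at most |G|/2 since N_G(P) > C_G(P) by
    Burnside's transfer theorem. So for every p in rho*, p divides |x^{G*}|
    for at least half of the x in G; as x = 1 contributes nothing, some
    sub-class size has more than |rho*|/2 prime divisors. *)
Require Import Defs.
From mathcomp Require Import all_boot all_fingroup all_solvable finalg.
Set Implicit Arguments.
Unset Strict Implicit.
Unset Printing Implicit Defensive.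
Local Open Scope group_scope.

(** * Induction along subnormal chains *)

Lemma subnormal_ind (gT : finGroupType) (G L : {group gT})
    (P : {group gT} -> Prop) :
    L <|<| G -> P L ->
    (forall H K : {group gT}, L \subset H -> H <| K -> K \subset G ->
       H <|<| G -> P H -> P K) ->
  P G.
Proof.
move=> snLG PL stepP; have [n leGn] := ubnP #|G|.
elim: n => // n IHn in G snLG stepP leGn *.
have [eqLG | [K [snLK nsKG ltKG]]] := subnormalEr snLG.
  by have <- : L = G by apply/val_inj.
apply: (stepP K); rewrite ?normal_subnormal ?(subnormal_sub snLK) //.
apply: IHn => // [H J sLH nsHJ sJK snHK|]; last first.
  exact: leq_trans (proper_card ltKG) _.
apply: stepP => //; first exact: subset_trans sJK (normal_sub nsKG).
exact: subnormal_trans snHK (normal_subnormal nsKG).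
Qed.

Section Subnormal.
Variable gT : finGroupType.
Implicit Types G H K L P : {group gT}.

Lemma Hall_setI_subnormal pi G K H :
  K <|<| G -> pi.-Hall(G) H -> pi.-Hall(K) (H :&: K).
Proof.
move=> snKG; move: H.
apply: (subnormal_ind (P := fun G => forall H, pi.-Hall(G) H -> _) snKG).
  by move=> H hallH; rewrite (setIidPl (pHall_sub hallH)).
move=> J I sKJ nsJI _ _ IH H hallH.
have := IH _ (Hall_setI_normal nsJI hallH).
by rewrite /= -setIA (setIidPr sKJ).
Qed.

Lemma subnormal_pcore pi G L : L <|<| G -> pi.-group L -> L \subset 'O_pi(G).
Proof.
move=> snLG piL.
apply: (subnormal_ind (P := fun G => L \subset 'O_pi(G)) snLG).
  by rewrite pcore_pgroup_id.
move=> H K _ nsHK _ _ sLH.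
apply: subset_trans sLH _; apply: pcore_max (pcore_pgroup _ _) _.
exact: gFnormal_trans.
Qed.

End Subnormal.

(** * Burnside's transfer theorem *)

Section Transfer.
Variables (gT : finGroupType) (p : nat) (G S : {group gT}).

(** The transfer into the abelian group [S] vanishes on the derived subgroup of [G], while on [S] it
    is the power map of exponent [#|G : S|], which is prime to the order of [S]. *)
Lemma Burnside_transfer :
  p.-Sylow(G) S -> 'N_G(S) \subset 'C(S) -> S :&: G^`(1) = 1.
Proof.
move=> sylS cSN; have [sSG pS p'SG] := and3P sylS.
have sSN : S \subset 'N_G(S) by rewrite subsetI sSG normG.
have cSS : abelian S := subset_trans sSN cSN.
have abS : abelian (idm S @* S) by rewrite morphim_idm.
pose V := transfer_morphism G abS.
apply/trivgP/subsetP=> g /setIP[Sg G'g]; have Gg := subsetP sSG g Sg.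
have Vg0 : V g = 1.
  have: V @* G^`(1) = 1.
    by rewrite morphim_der //; apply/derG1P/FinRing.zmod_abelian.
  by move/trivgP/subsetP/(_ (V g) (mem_morphim V Gg G'g))/set1P.
have [X trX] : exists X, is_transversal X (rcosets S G :* <[g]>) G.
  exists (transversal (rcosets S G :* <[g]>) G); apply: transversalP.
  by apply: rcosets_cycle_partition.
move: Vg0; rewrite /= (transfer_cycle_expansion sSG abS Gg trX).
(* Conjugates u, u' in S are conjugate in N_G(S), as S and S^x are both Sylow in
   C_G[u]; hence they are equal, and the transfer of g is g ^+ #|G : S|. *)
have cgx x : x \in X -> let u := g ^+ #|<[g]> : S :* x| in u ^ x^-1 = u.
  move=> Xx u; have Gx : x \in G := subsetP (transversal_sub trX) x Xx.
  have Su : u \in S by rewrite groupX.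
  have Su' : u ^ x^-1 \in S.
    have /rcosetP[s Ss xu] := mulg_exp_card_rcosets S g x.
    by rewrite conjgE invgK mulgA xu mulgK.
  have sylC v : v \in S -> p.-Sylow('C_G[v]) S.
    move=> Sv; apply: pHall_subl sylS; rewrite ?subsetIl // subsetI sSG.
    by rewrite sub_cent1 (subsetP cSS).
  have sylSx : p.-Sylow('C_G[u]) (S :^ x)%G.
    by have := sylC _ Su'; rewrite -(pHallJ2 _ _ _ x) conjIg conjGid
      // -cent1J conjgKV.
  have [c /setIP[Gc /cent1P cuc] defSx] := Sylow_trans (sylC u Su) sylSx.
  have Nxc : x * c^-1 \in 'N_G(S).
    by rewrite inE groupM ?groupV // inE conjsgM defSx conjsgK /=.
  have := centP (subsetP cSN _ Nxc) _ Su'.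
  move/esym/commgP/conjg_fixP; rewrite conjgM conjgKV => <-.
  by apply/conjg_fixP/commgP/commuteV.
move/(congr1 (@FiniteModule.fmval _ _ abS)); rewrite FiniteModule.fmval_sum.
rewrite (eq_bigr (fun x => g ^+ #|<[g]> : S :* x|)) => [|x Xx]; last first.
  rewrite /restrm /= /idm cgx //.
  by apply: FiniteModule.fmodK; rewrite /= morphim_idm // groupX.
(* The exponents are the orbit lengths of [<[g]>] on the right cosets of [S], so they add up to
   [#|G : S|]. *)
rewrite -(big_morph _ (expgD g) (expg0 g)).
rewrite (sum_index_rcosets_cycle sSG Gg trX) => /eqP.
rewrite -order_dvdn => dvd_g; apply/set1P/eqP; rewrite -order_eq1; apply/eqP.
exact: pnat_1 (mem_p_elt pS Sg) (pnat_dvd dvd_g p'SG).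
Qed.

End Transfer.

Lemma cosetpre_subnormal (gT : finGroupType) (N : {group gT})
    (K G : {group coset_of N}) :
  K <|<| G -> coset N @*^-1 K <|<| coset N @*^-1 G.
Proof.
move=> snKG.
apply: (subnormal_ind (P := fun G => _ <|<| coset N @*^-1 G) snKG)
  => [|H J _ nsHJ _ _ snKH].
  exact: subnormal_refl.
by apply: subnormal_trans snKH (normal_subnormal _); rewrite cosetpre_normal.
Qed.

(** * p-nilpotent groups *)

Definition p_nilpotent (p : nat) (gT : finGroupType) (G : {set gT}) :=
  p.-group (G / 'O_p^'(G)).

Section PNilpotent.
Variables (p : nat) (gT : finGroupType).
Implicit Types (G H K L M N P : {group gT}) (x : gT).

(** With [O] the p'-core, [O <*> <[x]>] is the preimage of a subgroup of a p-group, hence subnormal,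
    so it contains G_x. The sub-class size thus divides [#|O <*> <[x]> : <[x]>|], which divides
    [#|O|]. *)
Lemma p_nilpotent_sub_class G x :
  p_nilpotent p G -> x \in G -> p^'.-nat #|sub_class G x|.
Proof.
move=> nilG Gx; set O := 'O_p^'(G).
have nsOG : O <| G := pcore_normal _ _.
have nOx : <[x]> \subset 'N(O) by
  rewrite cycle_subG (subsetP (normal_norm nsOG)).
have sxG : <[x]> \subset G by rewrite cycle_subG.
have snHG : O <*> <[x]> <|<| G.
  have -> : O <*> <[x]> = coset O @*^-1 (<[x]> / O) :> {set gT}.
    by rewrite quotientK // norm_joinEr.
  rewrite -[X in _ <|<| X](quotientGK nsOG); apply: cosetpre_subnormal.
  by rewrite nilpotent_subnormal ?(pgroup_nil nilG) ?quotientS.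
have sLH : subnormal_closure G x \subset O <*> <[x]>.
  by apply: subnormal_closure_min snHG _; rewrite mem_gen // inE cycle_id orbT.
have sxL : <[x]> \subset subnormal_closure G x.
  by rewrite cycle_subG mem_subnormal_closure.
rewrite card_sub_class; apply: pnat_dvd (pcore_pgroup p^' G).
have sxC : <[x]> \subset 'C_(subnormal_closure G x)[x].
  by rewrite subsetI sxL cycle_subG cent1id.
apply: dvdn_trans (indexgS _ sxC) _.
apply: dvdn_trans (indexSg sxL sLH) _.
rewrite /= norm_joinEr // -(@dvdn_pmul2r #|<[x]>|) ?cardG_gt0 //.
rewrite -norm_joinEr // mulnC Lagrange ?joing_subr //= norm_joinEr //.
by rewrite -LagrangeMr dvdn_pmul2r ?cardG_gt0 // -indexgI dvdn_indexg.
Qed.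

(** The preimage [K] of the p'-core of [G / M] has [M] as a central Sylow p-subgroup. A
    Schur-Zassenhaus complement of [M] in [K] is then normal in [K], so it lies in the p'-core of
    [G], and its index in [G] is a power of [p]. *)
Lemma p_nilpotent_centralM G M :
  M \subset 'Z(G) -> p.-group M -> p_nilpotent p (G / M) -> p_nilpotent p G.
Proof.
move=> cMG pM nilGM; have nsMG : M <| G := sub_center_normal cMG.
have [K defK sMK nsKG] := inv_quotientN nsMG (pcore_normal p^' (G / M)).
have nsMK : M <| K := normalS sMK (normal_sub nsKG) nsMG.
have p'KM : p^'.-nat #|K : M|.
  by rewrite -card_quotient ?normal_norm // -defK; apply: pcore_pgroup.
have pGK : p.-nat #|G : K|.
  have := nilGM; rewrite /p_nilpotent /pgroup /= defK card_quotient
    ?quotient_norms ?normal_norm //.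
  by rewrite index_quotient_eq ?(normal_sub nsKG) ?(normal_norm nsMG)
    // subIset // sMK orbT.
have hallM : p.-Hall(K) M by apply/and3P.
have /splitsP[H /complP[tiMH defK']]
  := SchurZassenhaus_split (pHall_Hall hallM) nsMK.
have sHK : H \subset K by rewrite -defK' mulG_subr.
have cMK : K \subset 'C(M).
  by rewrite centsC (subset_trans cMG) // subIset // centS ?orbT ?normal_sub.
have p'H : p^'.-Hall(K) H.
  rewrite -(compl_pHall _ hallM); apply/complP; split => //.
have nsHK : H <| K.
  by rewrite /normal sHK -defK' mulG_subG normG cents_norm
    // centsC (subset_trans sHK).
have sHO : H \subset 'O_p^'(G).
  apply: subnormal_pcore (pHall_pgroup p'H).
  exact: subnormal_trans (normal_subnormal nsHK) (normal_subnormal nsKG).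
have pGH : p.-nat #|G : H|.
  rewrite -(Lagrange_index (normal_sub nsKG) sHK) pnatM pGK /=.
  by have /and3P[_ _] := p'H; rewrite (eq_pnat _ (negnK _)).
rewrite /p_nilpotent /pgroup card_quotient ?gFnorm //.
exact: pnat_dvd (indexgS _ sHO) pGH.
Qed.

End PNilpotent.

(** * The sets D_p and their behaviour in quotients *)

Definition p'_sub_class (p : nat) (gT : finGroupType) (G : {group gT}) :
    {set gT} :=
  [set x in G | p^'.-nat #|sub_class G x|].

Lemma leq_card_bigcup (I T : finType) (A : {pred I}) (F : I -> {set T}) :
  #|\bigcup_(i in A) F i| <= \sum_(i in A) #|F i|.
Proof.
apply: (big_ind2 (fun (B : {set T}) n => #|B| <= n)) => [|B m C n leBm leCn|//].
  by rewrite cards0.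
by apply: leq_trans (leq_card_setU B C) (leq_add leBm leCn).
Qed.

Lemma double_card_proper (gT : finGroupType) (H G : {group gT}) :
  H \proper G -> 2 * #|H| <= #|G|.
Proof.
case/andP=> sHG not_sGH.
by rewrite -(Lagrange sHG) mulnC leq_pmul2l ?cardG_gt0 ?indexg_gt1.
Qed.

Section SubClassPrime.
Variables (p : nat) (gT : finGroupType).
Implicit Types (G H K L M N P : {group gT}) (x : gT).

(** A Sylow p-subgroup of the centraliser of [x] in G_x has index prime to [p] in G_x. *)
Lemma p'_sub_class_cent G x :
  x \in p'_sub_class p G ->
  exists2 P : {group gT}, p.-Sylow(subnormal_closure G x) P & x \in 'C(P).
Proof.
rewrite inE => /andP[Gx]; rewrite card_sub_class.
set L := subnormal_closure_group G x => p'LC.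
have [P sylP] := Sylow_exists p 'C_L[x]; have [sPC pP p'CP] := and3P sylP.
exists P; last by rewrite -sub_cent1 (subset_trans sPC) ?subsetIr.
rewrite /pHall (subset_trans sPC) ?subsetIl // pP /=.
by rewrite -(Lagrange_index (subsetIl L 'C[x]) sPC) pnatM p'LC.
Qed.

(** G_x is subnormal in [L], so it meets [P] in a Sylow subgroup, which [x] centralises. Allowing
    any subnormal [L] lets the image of G_x serve in a quotient. *)
Lemma mem_p'_sub_class G L P x :
    L <|<| G -> x \in L -> p.-Sylow(L) P -> x \in 'C(P) ->
  x \in p'_sub_class p G.
Proof.
move=> snLG Lx sylP cPx; have Gx := subsetP (subnormal_sub snLG) x Lx.
rewrite inE Gx card_sub_class; set K := subnormal_closure_group G x.
have sKL : K \subset L := subnormal_closure_min snLG Lx.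
have snKL : K <|<| L.
  rewrite -(setIidPl sKL); apply: setI_subnormal (subnormal_sub snLG) _.
  exact: subnormal_closure_subnormal.
have /and3P[sPK _] := Hall_setI_subnormal snKL sylP.
apply: pnat_dvd; apply: indexgS; rewrite /= subsetI sPK /=.
by rewrite subIset // sub_cent1 cPx.
Qed.

End SubClassPrime.

Section Quotient.
Variables (p : nat) (gT : finGroupType).
Implicit Types (G H K L M N P : {group gT}) (x : gT).

Lemma quotient_p'_sub_class G N x :
  N <| G -> x \in p'_sub_class p G -> coset N x \in p'_sub_class p (G / N).
Proof.
move=> nsNG Dx; have [P sylP cPx] := p'_sub_class_cent Dx.
have /setIdP[Gx _] := Dx; have nNG := normal_norm nsNG.
set L := subnormal_closure_group G x in sylP.
have snLG : L <|<| G by apply: subnormal_closure_subnormal.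
have sPG := subset_trans (pHall_sub sylP) (subnormal_sub snLG).
have sylPN := quotient_pHall (subset_trans sPG nNG) sylP.
apply: (mem_p'_sub_class (quotient_subnormal N snLG) _ sylPN).
  by rewrite mem_quotient ?mem_subnormal_closure.
rewrite -cycle_subG -quotient_cycle ?(subsetP nNG) //.
by rewrite quotient_cents ?cycle_subG.
Qed.

(** Each fibre of D_p over the quotient lies in one coset of [N]; hence a bound on the density of
    D_p lifts from [G / N] to [G]. *)
Lemma card_quotient_p'_sub_class G N :
  N <| G -> #|p'_sub_class p G| <= #|N| * #|p'_sub_class p (G / N)|.
Proof.
move=> nsNG; have nNG := normal_norm nsNG.
rewrite -sum1_card (partition_big (coset N) [in p'_sub_class p (G / N)]) /=;
  last first.
  by move=> x; apply: quotient_p'_sub_class.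
rewrite mulnC -sum_nat_const leq_sum // => y Dy.
have /setIdP[/morphimP[x Nx Gx ->] _] := Dy.
rewrite sum1_card -(card_rcoset N x) subset_leq_card //.
apply/subsetP=> z /andP[/setIdP[Gz _] /eqP eq_zx].
rewrite -val_coset // -eq_zx val_coset ?rcoset_refl //.
exact: subsetP nNG z Gz.
Qed.

(** The Sylow subgroups of [M] are conjugate, so their centralisers have equal order. The Frattini
    argument gives [#|M : 'N_M(P)| * #|'N_G(P)| = #|G|], and the factor 2 comes from ['C_G(P)] being
    proper in ['N_G(P)]. *)
Lemma card_cent_Sylow G M P :
    M <| G -> p.-Sylow(M) P -> ~~ ('N_G(P) \subset 'C(P)) ->
  2 * #|\bigcup_(Q in 'Syl_p(M)) 'C_G(Q)| <= #|G|.
Proof.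
move=> nsMG sylP notCN.
have le_union : #|\bigcup_(Q in 'Syl_p(M)) 'C_G(Q)|
  <= #|M : 'N_M(P)| * #|'C_G(P)|.
  apply: leq_trans (leq_card_bigcup _ _) _.
  rewrite -(card_Syl sylP) -sum_nat_const leq_sum // => Q.
  rewrite inE => sylQ; have [m Mm ->] := Sylow_trans sylP sylQ.
  rewrite centJ -{1}(conjGid (subsetP (normal_sub nsMG) m Mm)) -conjIg.
  by rewrite cardJg.
have prCN : 'C_G(P) \proper 'N_G(P).
  rewrite properE setIS ?cent_sub //; apply: contra notCN => sNC.
  exact: subset_trans sNC (subsetIr _ _).
have <- : (#|M : 'N_M(P)| * #|'N_G(P)|)%N = #|G|.
  rewrite -[RHS](congr1 (fun A : {set gT} => #|A|) (Frattini_arg nsMG sylP)).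
  rewrite -LagrangeMr; congr (_ * _)%N.
  by rewrite -(indexgI M 'N_G(P)) setIA (setIidPl (normal_sub nsMG)).
apply: leq_trans (leq_mul (leqnn 2) le_union) _.
by rewrite mulnCA leq_mul // double_card_proper.
Qed.

End Quotient.

(** * Abelian minimal normal subgroups *)

Section AbelianMinNormal.
Variables (p : nat) (gT : finGroupType) (G M : {group gT}).
Hypotheses (nsMG : M <| G) (cMM : abelian M).

(** For [H <| K] in a chain from [L] to [G], [[~: M :&: K, A]] lies in [M :&: H], which [A] already
    centralises; coprime action on an abelian group makes this commutator trivial. *)
Lemma coprime_cent_subnormal (L A : {group gT}) :
    L <|<| G -> A \subset L -> coprime #|M| #|A| -> M :&: L \subset 'C(A) ->
  M \subset 'C(A).
Proof.
move=> snLG sAL coMA cML; rewrite -(setIidPl (normal_sub nsMG)).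
apply: (subnormal_ind (P := fun K : {group gT} => M :&: K \subset 'C(A)) snLG)
  => //.
move=> H K sLH nsHK sKG snHG cMH.
have sAH := subset_trans sAL sLH.
have sAK := subset_trans sAH (normal_sub nsHK).
have nMA : A \subset 'N(M).
  exact: subset_trans (subset_trans sAK sKG) (normal_norm nsMG).
have nBA : A \subset 'N(M :&: K) by rewrite normsI // (subset_trans sAK) ?normG.
have cMKA := coprimeSg (subsetIl M K) coMA.
have := coprime_abel_cent_TI nBA cMKA (abelianS (subsetIl M K) cMM).
rewrite (setIidPl _); first by move/commG1P.
apply: subset_trans cMH; rewrite subsetI; apply/andP; split.
  by apply: subset_trans (commSg _ (subsetIl _ _)) _; rewrite commg_subl.
apply: subset_trans (commgSS (subsetIr _ _) sAH) _.
by rewrite commg_subr normal_norm.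
Qed.

Hypotheses (minM : minnormal M G) (pM : p.-group M).

(** [H] acts on [M] as its Sylow p-subgroup [Q] does. In the p-group [M <*> Q], [M] meets the
    centre, so ['C_M(H)] is nontrivial; being normal in [G], it is [M]. *)
Lemma minnormal_pquotient_cent (H : {group gT}) :
  H <| G -> p.-group (H / 'C_G(M)) -> H \subset 'C(M).
Proof.
move=> nsHG pHC; have [ntM nMG] := andP (mingroupp minM).
have [Q sylQ] := Sylow_exists p H; have [sQH pQ _] := and3P sylQ.
have sQG := subset_trans sQH (normal_sub nsHG).
have nsCG : 'C_G(M) <| G by rewrite /normal subsetIl normsI ?normG ?norms_cent.
have nCH := subset_trans (normal_sub nsHG) (normal_norm nsCG).
have sHQC : H \subset 'C_G(M) * Q.
  rewrite -quotientSK //; have sylQC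
    := quotient_pHall (subset_trans sQH nCH) sylQ.
  by rewrite -(pHall_id sylQC pHC).
have nMQ := subset_trans sQG nMG.
have pMQ : p.-group (M <*> Q) by rewrite norm_joinEr // pgroupM pM.
have nsMQ : M <| M <*> Q by rewrite /normal joing_subl join_subG normG.
have ntCQ : 'C_M(Q) != 1.
  apply: contraNneq (meet_center_nil (pgroup_nil pMQ) nsMQ ntM) => CQ1.
  rewrite -subG1 -CQ1 setIS //; apply: subset_trans (subsetIr _ _) _.
  by rewrite centS ?joing_subr.
have ntCH : 'C_M(H) != 1.
  apply: contraNneq ntCQ => CH1; rewrite -subG1 -CH1 subsetI subsetIl /=.
  rewrite centsC (subset_trans sHQC) // mul_subG //;
    last by rewrite centsC subsetIr.
  by rewrite subIset // centS ?orbT ?subsetIl.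
have nCHG : G \subset 'N('C_M(H)) by rewrite normsI ?norms_cent ?normal_norm.
have [_ /(_ ('C_M(H))%G)] := mingroupP minM.
rewrite ntCH nCHG => /(_ isT (subsetIl _ _)) defCH.
by rewrite centsC -defCH subsetIr.
Qed.

Lemma abelian_minnormal_p'_sub_class : p'_sub_class p G \subset 'C(M).
Proof.
apply/subsetP=> x Dx; have [P sylP cPx] := p'_sub_class_cent Dx.
have /setIdP[Gx _] := Dx; set L := subnormal_closure_group G x in sylP *.
have snLG : L <|<| G by apply: subnormal_closure_subnormal.
have sLG := subnormal_sub snLG; have nML := subset_trans sLG (normal_norm nsMG).
have nsMLL : M :&: L <| L by rewrite /normal subsetIr normsI ?normG.
have pML : p.-group (M :&: L) := pgroupS (subsetIl _ _) pM.
have sMLP : M :&: L \subset P.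
  exact: subset_trans (pcore_max pML nsMLL) (pcore_sub_Hall sylP).
(* ['C_L(M :&: L)] is subnormal in [G] and contains [x], so it is all of G_x. *)
have cMLL : L \subset 'C(M :&: L).
  have nsCL : 'C_L(M :&: L) <| L.
    by rewrite /normal subsetIl normsI ?normG ?norms_cent ?normal_norm.
  have snCG := subnormal_trans (normal_subnormal nsCL) snLG.
  apply: subset_trans (subnormal_closure_min snCG _) (subsetIr _ _).
  by rewrite inE mem_subnormal_closure (subsetP (centS sMLP)).
have nsCG : 'C_G(M) <| G.
  by rewrite /normal subsetIl normsI ?normG ?norms_cent ?normal_norm.
have nCL := subset_trans sLG (normal_norm nsCG).
(* The p'-part of each [y] in [L] centralises [M], so its coset is trivial. *)
have pLC : p.-group (L / 'C_G(M)).
  apply/pgroupP=> q q_pr /Cauchy[//|_ /morphimP[y Ny Ly ->] oy].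
  have: p.-elt (coset 'C_G(M) y).
    rewrite -[p.-elt _](eq_p_elt _ (negnK _)) /=; apply/constt1P.
    rewrite -morph_constt //; apply: coset_id; rewrite inE.
    rewrite groupX ?(subsetP sLG) //= -cycle_subG centsC.
    apply: coprime_cent_subnormal snLG _ _ _.
    - by rewrite cycle_subG groupX.
    - exact: pnat_coprime pM (p_elt_constt p^' y).
    by rewrite centsC (subset_trans _ cMLL) // cycle_subG groupX.
  by rewrite /p_elt oy pnatE.
have [H defH sCH nsHG] := inv_quotientN nsCG (pcore_normal p (G / 'C_G(M))).
have sLH : L \subset H.
  rewrite -(quotientSGK nCL sCH) -defH.
  exact: subnormal_pcore (quotient_subnormal _ snLG) pLC.
apply: (subsetP (minnormal_pquotient_cent nsHG _)).
  by rewrite -defH; apply: pcore_pgroup.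
by rewrite (subsetP sLH) ?mem_subnormal_closure.
Qed.

End AbelianMinNormal.

(** * Nonabelian minimal normal subgroups *)

Section NonabelianMinNormal.
Variables (gT : finGroupType) (G M : {group gT}).
Hypotheses (nsMG : M <| G) (minM : minnormal M G).

(* M is generated by the G-conjugates of a minimal normal subgroup S of M, and
   each conjugate is either contained in A or centralises A. *)
Lemma minnormal_sub_mul_cent (A : {group gT}) : A <| M -> M \subset A * 'C_M(A).
Proof.
move=> nsAM; have [ntM nMG] := andP (mingroupp minM).
have [S minS sSM] := minnormal_exists ntM (normG M).
have [ntS nSM] := andP (mingroupp minS).
have nAC : 'C_M(A) \subset 'N(A) by rewrite subIset // normal_norm.
have defM : <<class_support S G>> = M.
  have [_ minM_] := mingroupP minM;
    apply: (minM_ [group of <<class_support S G>>]).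
    rewrite norms_gen ?class_support_norm // andbT -subG1.
    apply: contra ntS; rewrite -subG1; apply: subset_trans.
    exact: subset_trans (sub_class_support _ _) (subset_gen _).
  by rewrite gen_subG class_support_sub_norm.
rewrite -{1}defM -(norm_joinEr nAC) gen_subG class_supportEr;
  apply/bigcupsP=> g Gg.
have nMg h : h \in G -> M :^ h = M.
  by move=> Gh; rewrite (normP (subsetP nMG h Gh)).
have nsAgM : A :^ g^-1 <| M by rewrite -(nMg _ (groupVr Gg)) normalJ.
have nSA : S \subset 'N(A :^ g^-1) := subset_trans sSM (normal_norm nsAgM).
have nASM : M \subset 'N(S :&: A :^ g^-1) by rewrite normsI // normal_norm.
have [/eqP tiSA | ntSA] := boolP (S :&: A :^ g^-1 == 1).
  apply: subset_trans (joing_subr _ _);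
    rewrite subsetI -{1}(nMg g Gg) conjSg sSM /=.
  rewrite sub_conjg -centJ; apply/commG1P/trivgP; rewrite -tiSA.
  apply: commg_subI; rewrite subsetI ?subxx ?nSA //=.
  by rewrite (subset_trans (normal_sub nsAgM)).
have [_ /(_ (S :&: A :^ g^-1)%G)] := mingroupP minS.
rewrite ntSA nASM => /(_ isT (subsetIl _ _)) defS.
by apply: subset_trans (joing_subl _ _); rewrite sub_conjg -defS subsetIr.
Qed.

(** Descending a chain with [A <| K] and [K <| M], one has [M = K * 'C_M(K)], and both factors
    normalise [A]. *)
Lemma minnormal_subnormal_normal (A : {group gT}) : A <|<| M -> A <| M.
Proof.
have [n leAn] := ubnP (#|M| - #|A|); elim: n => // n IHn in A leAn *.
move=> snAM; have [-> | [K [nsAK snKM prAK]]] := subnormalEl snAM.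
  exact: normal_refl.
have ltAK := proper_card prAK.
have leKM := subset_leq_card (subnormal_sub snKM).
have nsKM : K <| M.
  apply: IHn snKM; rewrite ltnS in leAn; apply: leq_trans leAn.
  by rewrite ltn_sub2l // (leq_trans ltAK).
rewrite /normal (subnormal_sub snAM).
rewrite (subset_trans (minnormal_sub_mul_cent nsKM)) //.
rewrite mul_subG ?(normal_norm nsAK) // cents_norm // subIset //.
by rewrite centS ?orbT ?normal_sub.
Qed.

Hypothesis ZM1 : 'Z(M) = 1.

Lemma minnormal_normal_center (A : {group gT}) : A <| M -> 'Z(A) = 1.
Proof.
move=> nsAM; apply/trivgP; rewrite -ZM1 subsetI.
rewrite (subset_trans (center_sub A) (normal_sub nsAM)) centsC.
apply: subset_trans (minnormal_sub_mul_cent nsAM) _.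
rewrite mul_subG //; first by rewrite centsC subsetIr.
by rewrite subIset // centS ?orbT ?center_sub.
Qed.

(** In the decomposition of [M] as [M :&: L] times [C], the group [L] acts trivially on the second
    factor. The proof climbs from [L] to [G], showing that [L] centralises [C :&: K] for each term
    [K]; at the bottom, [C :&: L] is the centre of [M :&: L], hence trivial. *)
Lemma minnormal_cent_subnormal (L : {group gT}) :
  L <|<| G -> 'C_M(M :&: L) \subset 'C(L).
Proof.
move=> snLG; set C := 'C_M(M :&: L).
have sMG := normal_sub nsMG.
have nML := subset_trans (subnormal_sub snLG) (normal_norm nsMG).
have snI (K : {group gT}) : K <|<| G -> M :&: K <| M.
  by move=> snKG; rewrite setIC;
    exact: minnormal_subnormal_normal (setI_subnormal sMG snKG).
have nCL : L \subset 'N(C) by rewrite normsI ?norms_cent // normsI ?normG.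
have nsCM : C <| M.
  by rewrite /normal subsetIl /= normsI ?normG // norms_cent // normal_norm
    ?snI.
rewrite -(setIidPl (subset_trans (normal_sub nsCM) sMG)).
apply: (subnormal_ind (P := fun K : {group gT} => C :&: K \subset 'C(L)) snLG).
  suffices -> : C :&: L = 1 by apply: sub1G.
  rewrite -(minnormal_normal_center (snI _ snLG)) /C /= /center.
  by rewrite -setIA [_ :&: L]setIC setIA.
move=> H K sLH nsHK sKG snHG cEL.
have sHK := normal_sub nsHK; have sLK := subset_trans sLH sHK.
have nsEM : C :&: H <| M.
  apply: minnormal_subnormal_normal.
  have nsEI : C :&: H <| M :&: H.
    rewrite /normal setSI ?(normal_sub nsCM) // normsI //.
      by rewrite subIset // normal_norm.
    by rewrite subIset // normG orbT.
  apply: subnormal_trans (normal_subnormal nsEI) _.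
  exact/normal_subnormal/snI.
have nDL : L \subset 'N(C :&: K) by rewrite normsI // (subset_trans sLK) ?normG.
(* With D = C :&: K and E = C :&: H, [D, L] lies in E, which L centralises; so
   [D, L] centralises E by the three subgroup lemma, and lies in Z(E) = 1. *)
have sDLE : [~: C :&: K, L] \subset C :&: H.
  rewrite subsetI (subset_trans (commSg _ (subsetIl _ _))) ?commg_subl //=.
  by rewrite (subset_trans (commgSS (subsetIr _ _) sLH))
    // commg_subr normal_norm.
apply/commG1P/trivgP; rewrite -(minnormal_normal_center nsEM) subsetI sDLE /=.
rewrite (comm_norm_cent_cent nDL) //; first by rewrite centsC.
have nCC : C \subset 'N(C) := normG _.
apply: normsI; first by rewrite subIset ?nCC.
by rewrite subIset // (normal_norm nsHK) orbT.
Qed.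

(** [M] is the direct product of [A] and [C]. As [x] centralises a Sylow subgroup of [A] and all of
    [C], it centralises a Sylow subgroup of [M]. *)
Lemma nonabelian_minnormal_p'_sub_class (p : nat) :
  p'_sub_class p G \subset \bigcup_(Q in 'Syl_p(M)) 'C_G(Q).
Proof.
apply/subsetP=> x Dx; have [P sylP cPx] := p'_sub_class_cent Dx.
have /setIdP[Gx _] := Dx; set L := subnormal_closure_group G x in sylP *.
have snLG : L <|<| G by apply: subnormal_closure_subnormal.
have Lx : x \in L := mem_subnormal_closure G x.
have nML := subset_trans (subnormal_sub snLG) (normal_norm nsMG).
have nsAL : M :&: L <| L by rewrite /normal subsetIr normsI ?normG.
have nsAM : M :&: L <| M.
  rewrite setIC; apply: minnormal_subnormal_normal.
  exact: setI_subnormal (normal_sub nsMG) snLG.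
have sylA : p.-Sylow(M :&: L) (M :&: L :&: P) := Sylow_setI_normal nsAL sylP.
set A := (M :&: L)%G in nsAL nsAM sylA; set C := ('C_M(A))%G.
have [R sylR] := Sylow_exists p C.
have defM : A \x C = M.
  rewrite dprodE ?subsetIr //.
    apply/eqP; rewrite eqEsubset minnormal_sub_mul_cent // mul_subG ?subsetIl
      //.
  have := minnormal_normal_center nsAM; rewrite /center => Z1.
  by apply/trivgP; rewrite -Z1 setIS ?subsetIr.
have [sRC pR _] := and3P sylR; have [sQA pQ _] := and3P sylA.
have [_ _ cAC tiAC] := dprodP defM.
have cQR : R \subset 'C(M :&: L :&: P) by rewrite (subset_trans sRC)
  // (subset_trans cAC) ?centS.
have sylQR : p.-Sylow(M) ((M :&: L :&: P) <*> R).
  rewrite pHallE join_subG (subset_trans sQA (normal_sub nsAM)).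
  rewrite (subset_trans sRC (subsetIl _ _)) /= cent_joinEr //.
  rewrite TI_cardMg; last by apply/trivgP; rewrite -tiAC setISS.
  by rewrite -(dprod_card defM) partnM ?cardG_gt0
    // (card_Hall sylA) (card_Hall sylR).
apply/bigcupP; exists ((M :&: L :&: P) <*> R)%G; first by rewrite inE.
rewrite inE Gx /= centY inE; apply/andP; split.
  by rewrite (subsetP _ _ cPx) // centS ?subsetIr.
have : x \in 'C(C) by rewrite (subsetP _ _ Lx)
  // centsC minnormal_cent_subnormal.
by apply: subsetP; rewrite centS.
Qed.

End NonabelianMinNormal.

(** * The bound on D_p for groups that are not p-nilpotent *)

Lemma minnormal_char (gT : finGroupType) (G M K : {group gT}) :
  minnormal M G -> K \char M -> K :!=: 1 -> K :=: M.
Proof.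
move=> /minnormal_charsimple/charsimpleP[_ simM] chKM ntK.
exact: simM ntK chKM.
Qed.

Lemma p_nilpotent_p'quotient (p : nat) (gT : finGroupType) (G N : {group gT}) :
  N <| G -> p^'.-group N -> p_nilpotent p (G / N) -> p_nilpotent p G.
Proof.
move=> nsNG p'N; have sNO := pcore_max p'N nsNG; have nNG := normal_norm nsNG.
rewrite /p_nilpotent pquotient_pcore // /pgroup !card_quotient ?quotient_norms
  ?gFnorm //.
by rewrite index_quotient_eq ?pcore_sub // subIset // sNO orbT.
Qed.

Lemma card_p'_sub_class (p : nat) (gT : finGroupType) (G : {group gT}) :
  ~~ p_nilpotent p G -> 2 * #|p'_sub_class p G| <= #|G|.
Proof.
have [n leGn] := ubnP #|G|; elim: n => // n IHn in gT G leGn *.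
move=> not_nilG.
have [/existsP[N /and3P[nsNG ntN not_nilGN]] | /existsPn nilGN] :=
    boolP [exists N : {group gT},
             [&& N <| G, N :!=: 1 & ~~ p_nilpotent p (G / N)]].
  have [sNG nNG] := andP nsNG.
  apply: leq_trans (leq_mul (leqnn 2) (card_quotient_p'_sub_class p nsNG)) _.
  rewrite mulnCA -(Lagrange sNG) -(card_quotient nNG) leq_mul // IHn //.
  exact: leq_trans (ltn_quotient ntN sNG) leGn.
have {}nilGN (N : {group gT}) : N <| G -> N :!=: 1 -> p_nilpotent p (G / N).
  by move=> nsNG ntN; have := nilGN N; rewrite nsNG ntN negbK.
have ntG : G :!=: 1.
  apply: contra not_nilG => /eqP->; rewrite /p_nilpotent quotient1;
    exact: pgroup1.
have [M minM sMG] := minnormal_exists ntG (normG G).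
have [ntM nMG] := andP (mingroupp minM).
have nsMG : M <| G by apply/andP.
have not_p'M : ~~ p^'.-group M.
  by apply: contra not_nilG => p'M; apply: (p_nilpotent_p'quotient nsMG p'M);
    apply: nilGN.
have [cMM | not_cMM] := boolP (abelian M).
  have pM : p.-group M.
    have [Op'M1 | ntOp'M] := eqVneq 'O_p^'(M) 1.
      have := nilpotent_pcoreC p (abelian_nil cMM); rewrite Op'M1 dprodg1 => <-.
      exact: pcore_pgroup.
    case/negP: not_p'M; rewrite -(minnormal_char minM (pcore_char _ _) ntOp'M).
    exact: pcore_pgroup.
  apply: leq_trans (double_card_proper (H := 'C_G(M)) _).
    rewrite leq_mul2l subset_leq_card
      // subsetI abelian_minnormal_p'_sub_class // andbT.
    by apply/subsetP=> x /setIdP[].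
  rewrite properE subsetIl subsetI subxx /=; apply: contra not_nilG => cGM.
  apply: (p_nilpotent_centralM (M := M)) => //; last exact: nilGN.
  by rewrite subsetI sMG centsC.
have ZM1 : 'Z(M) = 1.
  apply: contraNeq not_cMM => ntZ.
  by rewrite -(minnormal_char minM (center_char M) ntZ) center_abelian.
have [P sylP] := Sylow_exists p M.
have leG := card_cent_Sylow nsMG sylP.
apply: leq_trans (leq_mul (leqnn 2) (subset_leq_card _)) (leG _).
  exact: nonabelian_minnormal_p'_sub_class.
(* Otherwise transfer gives [P] trivial intersection with the derived subgroup of [M], which is [M]
   itself; then [P] is trivial and [M] is a p'-group. *)
apply: contra not_p'M => sNC.
have := Burnside_transfer sylP (subset_trans (setSI _ sMG) sNC).
rewrite (minnormal_char (K := M^`(1)%G) minM (der_char 1 M)); last first.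
  by apply: contra not_cMM => /eqP/derG1P.
rewrite (setIidPl (pHall_sub sylP)) => P1.
by rewrite -partG_eq1 -(card_Hall sylP) P1 cards1.
Qed.

(** A subgroup [H] of [G] inside [[~: H, G]] dies in every nilpotent quotient, so it lies in every
    p'-core and is trivial. *)
Lemma p_nilpotent_nilpotent (gT : finGroupType) (G : {group gT}) :
  (forall p, prime p -> p_nilpotent p G) -> nilpotent G.
Proof.
move=> nilG; apply/forall_inP=> H; rewrite subsetI => /andP[sHG sHR].
have p'H p : prime p -> p^'.-group H.
  move=> p_pr; have nOG : G \subset 'N('O_p^'(G)) := gFnorm _ _.
  apply: pgroupS (pcore_pgroup p^' G).
  rewrite -quotient_sub1 ?(subset_trans sHG) // subG1.
  apply: (forall_inP (pgroup_nil (nilG p p_pr)) (H / 'O_p^'(G))%G).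
  by rewrite subsetI quotientS // -quotientR ?(subset_trans sHG) ?quotientS.
apply: contraT => ntH; have p_pr := pdiv_prime (etrans (cardG_gt1 H) ntH).
by have := p'H _ p_pr; rewrite /pgroup p'natE // pdiv_dvd.
Qed.

(** * Averaging over the group *)

(** This makes the final inequality strict. Were there no primes, every D_p would be [G], so [G]
    would be p-nilpotent for all [p]. *)
Lemma rho_star_gt0 (gT : finGroupType) (G : {group gT}) :
  ~~ nilpotent G -> 0 < size (rho_star G).
Proof.
move=> not_nilG; rewrite lt0n; apply: contra not_nilG => /nilP rho0.
apply: p_nilpotent_nilpotent => p p_pr; apply: contraT => not_nilG.
have := card_p'_sub_class not_nilG; have -> : p'_sub_class p G = G.
  apply/setP=> x; rewrite inE andb_idr // => Gx.
  rewrite p'natE //; apply/negP=> dvp.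
  suffices : p \in rho_star G by rewrite rho0.
  apply/mem_rho_star; exists x => //.
  rewrite mem_primes p_pr dvp andbT /=; apply/card_gt0P; exists x.
  exact: class_refl.
by rewrite leqNgt -[X in X < _]mul1n ltn_pmul2r ?cardG_gt0.
Qed.

Lemma rho_star_not_p_nilpotent (p : nat) (gT : finGroupType) (G : {group gT}) :
  p \in rho_star G -> ~~ p_nilpotent p G.
Proof.
case/mem_rho_star=> x Gx; rewrite mem_primes => /and3P[p_pr _ dvp].
apply: contraL dvp => nilG.
by have := p_nilpotent_sub_class nilG Gx; rewrite p'natE.
Qed.

Lemma card_rho_star_prime (p : nat) (gT : finGroupType) (G : {group gT}) :
    p \in rho_star G ->
  #|G| <= 2 * \sum_(x in G) (p \in primes #|sub_class G x|).
Proof.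
move=> rho_p; have := card_p'_sub_class (rho_star_not_p_nilpotent rho_p).
have sDG : p'_sub_class p G \subset G by apply/subsetP=> x /setIdP[].
have [_ _ p_pr] : exists2 x, x \in G & prime p.
  case/mem_rho_star: rho_p => x Gx; rewrite mem_primes => /and3P[p_pr _ _].
  by exists x.
have -> : \sum_(x in G) (p \in primes #|sub_class G x|)
  = #|G :\: p'_sub_class p G|.
  rewrite -sum1_card big_mkcond [RHS]big_mkcond /=; apply: eq_bigr => x _.
  rewrite !inE p'natE // mem_primes p_pr negb_and negbK /=.
  have -> : 0 < #|sub_class G x| by apply/card_gt0P; exists x;
    apply: class_refl.
  by case: (x \in G); rewrite /= ?andbT //; case: (_ %| _).
rewrite cardsD (setIidPr sDG) mulnBr => leDG.
by rewrite leq_subRL ?leq_mul2l ?subset_leq_card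
  // [leqRHS]mul2n -addnn leq_add2r.
Qed.

Theorem theorem1p1 (gT : finGroupType) (G : {group gT}) :
  ~~ nilpotent G -> size (rho_star G) < 2 * sigma_star G.
Proof.
move=> not_nilG; rewrite ltnNge; apply/negP=> le_sigma_rho.
have rho_gt0 := rho_star_gt0 not_nilG.
pose pi x := primes #|sub_class G x|.
have pi1 : pi 1 = [::] by rewrite /pi /sub_class class1G cards1.
(* The identity contributes nothing, whence the factor [#|G|.-1]. *)
have : 2 * \sum_(x in G) size (pi x) <= #|G|.-1 * size (rho_star G).
  rewrite (cardD1 1) group1 /= add0n (bigD1 1)
    //= pi1 add0n -sum_nat_const big_distrr /=.
  rewrite (eq_bigl [in [predD1 G & 1]]); last by move=> x; rewrite !inE andbC.
  apply: leq_sum => x /andP[_ Gx]; apply: leq_trans le_sigma_rho.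
  by rewrite leq_mul2l /= (bigmax_sup x).
apply/negP; rewrite -ltnNge.
apply: (@leq_trans (#|G| * size (rho_star G))).
  by rewrite ltn_pmul2r // prednK ?cardG_gt0.
(* Count the pairs of [x] and [p] with [p] in [pi x]: each [p] occurs for at least half of the
   elements, and each [x] for at most [size (pi x)] primes. *)
apply: (@leq_trans (\sum_(p <- rho_star G) 2 * \sum_(x in G) (p \in pi x))).
  rewrite mulnC -sum1_size big_distrl /= !big_seq.
  by apply: leq_sum => p /card_rho_star_prime; rewrite mul1n.
rewrite -big_distrr leq_mul2l /= exchange_big leq_sum // => x _.
rewrite -big_mkcond sum1_count -size_filter uniq_leq_size ?filter_uniq
  ?undup_uniq //.
by move=> p; rewrite mem_filter => /andP[].
Qed.
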